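(* Let $n\ge2$, $m\in\mathbb{N}$, and let $(\alpha_j,\beta_j)$, $j=1,\dots,m$, be arbitrary intervals satisfying $$0<\alpha_1,\quad \alpha_j<\beta_j<\alpha_{j+1}\ (j=1,\dots,m-1),\quad \alpha_m<\beta_m<\infty .$$ Choose, for $j=1,\dots,m$, $$d_j=\begin{cases}\left[\dfrac{2(\beta_j-\alpha_j)}{\omega_{n-1}(n-2)}\displaystyle\prod_{i\in\{1,\dots,m\},\,i\ne j}\left(\frac{\beta_i-\alpha_j}{\alpha_i-\alpha_j}\right)\right]^{\frac1{n-2}},&n>2,\\[3mm] \dfrac{\beta_j-\alpha_j}{\pi}\displaystyle\prod_{i\in\{1,\dots,m\},\,i\ne j}\left(\frac{\beta_i-\alpha_j}{\alpha_i-\alpha_j}\right),&n=2,\end{cases}$$ $$b_j=\left[\frac{\beta_j-\alpha_j}{\omega_n\alpha_j}\prod_{i\in\{1,\dots,m\},\,i\ne j}\left(\frac{\beta_i-\alpha_j}{\alpha_i-\alpha_j}\right)\right]^{\frac1n}.$$ Then the numbers $\sigma_j$, $\mu_j$ determined by these $d_j,b_j$ satisfy $$\sigma_j=\alpha_j,\qquad \mu_j=\beta_j,\qquad j=1,\dots,m.$$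
   Context: $\omega_n$ denotes the volume of the $n$-dimensional unit sphere (in $\mathbb{R}^{n+1}$). Given positive constants $d_j,b_j$ ($j=1,\dots,m$), which parametrise the hole radii ($d_j\varepsilon^{n/(n-2)}$ if $n>2$, $\exp(-1/(d_j\varepsilon^2))$ if $n=2$) and the bubble radii ($b_j\varepsilon$) of a family of $n$-dimensional periodic manifolds $M^\varepsilon$ ($\mathbb{R}^n$ with $\varepsilon$-periodic holes to which truncated spheres, the bubbles, are glued), the associated numbers are defined by $$\sigma_j=\frac{d_j}{4b_j^2}\ (n=2),\qquad \sigma_j=\frac{n-2}{2}\cdot\frac{d_j^{n-2}\omega_{n-1}}{b_j^n\omega_n}\ (n>2),\qquad \rho_j=b_j^n\omega_n,$$ and, when $\sigma_1<\dots<\sigma_m$, $\mu_1,\dots,\mu_m$ are the roots of the equation $$1+\sum_{j=1}^m\frac{\sigma_j\rho_j}{\sigma_j-\lambda}=0\qquad(\lambda\in\mathbb{R}),$$ which has exactly $m$ roots, numbered so that $\sigma_j<\mu_j<\sigma_{j+1}$ for $j=1,\dots,m-1$ and $\sigma_m<\mu_m<\infty$. Under the hypothesis on the intervals, the expressions raised to fractional powers are positive. *)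

(* Defs.v *)
From HB Require Import structures.
From mathcomp Require Import all_boot all_order all_algebra.
From mathcomp Require Import all_classical all_reals all_analysis.

Set Implicit Arguments.
Unset Strict Implicit.
Unset Printing Implicit Defensive.

Import Order.TTheory GRing.Theory Num.Theory.
Import numFieldNormedType.Exports.

Local Open Scope classical_set_scope.
Local Open Scope ring_scope.

(* Lebesgue measure on R^n is the n-fold product of the one-dimensional
   Lebesgue measure, on the carrier R * (R * ... (R * unit)); [Rn_vec]
   identifies this carrier with the normed space of row vectors, on which the
   library has differentials but no measure. *)
Fixpoint Rn_sig (R : realType) (n : nat) :
    {d : measure_display & measurableType d} :=
  if n is n'.+1
  then existT (fun d => measurableType d) _
         ((measurableTypeR R * projT2 (Rn_sig R n'))%type : measurableType _)
  else existT (fun d => measurableType d) _ (unit : measurableType _).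

Definition Rn (R : realType) (n : nat) : measurableType (projT1 (Rn_sig R n)) :=
  projT2 (Rn_sig R n).

(* Sigma-finiteness of [m1 \x m2] is proved in the library, but its instance is
   shadowed by the one for subprobabilities, hence this named copy. *)
Section lebesgue_prod.
Context (R : realType) (d : measure_display) (T : measurableType d).
Variable mu : {sigma_finite_measure set T -> \bar R}.

Definition lebesgue_prod : set (measurableTypeR R * T)%type -> \bar R :=
  product_measure1 (@lebesgue_measure R) mu.

HB.instance Definition _ := Measure.on lebesgue_prod.

Lemma lebesgue_prod_sigma_finite : sigma_finite setT lebesgue_prod.
Proof.
have /sigma_finiteP[F [TF ndF Foo]] := sigma_finiteT (@lebesgue_measure R).
have /sigma_finiteP[G [TG ndG Goo]] := sigma_finiteT mu.
exists (fun n => F n `*` G n).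
  rewrite -setXTT TF TG predeqE => -[x y]; split.
    move=> [/= [n _ Fnx] [k _ Gky]]; exists (maxn n k) => //; split.
    - by move: x Fnx; exact/subsetPset/ndF/leq_maxl.
    - by move: y Gky; exact/subsetPset/ndG/leq_maxr.
  by move=> [n _ []/= ? ?]; split; exists n.
move=> k; have [? ?] := Foo k; have [? ?] := Goo k.
split; first exact: measurableX.
by rewrite /lebesgue_prod product_measure1E// lte_mul_pinfty// ge0_fin_numE.
Qed.

HB.instance Definition _ := Measure_isSigmaFinite.Build _ _ _ lebesgue_prod
  lebesgue_prod_sigma_finite.

End lebesgue_prod.

Fixpoint lebesgue_Rn (R : realType) (n : nat) :
    {sigma_finite_measure set (Rn R n) -> \bar R} :=
  match n return {sigma_finite_measure set (Rn R n) -> \bar R} with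
  | 0 => dirac tt
  | n'.+1 => lebesgue_prod (lebesgue_Rn R n')
  end.

Fixpoint Rn_vec (R : realType) (n : nat) : Rn R n -> 'rV[R]_n :=
  match n return Rn R n -> 'rV[R]_n with
  | 0 => fun _ => 0
  | n'.+1 => fun x => row_mx (x.1%:M : 'rV[R]_1) (Rn_vec x.2)
  end.

(* n-dimensional Riemannian volume of the surface parametrised by
   [phi : D -> R^k]. The rows of ['J phi x] are the partial derivatives of phi,
   so ['J phi x *m ('J phi x)^T] is the matrix of the induced metric. *)
Definition surface_volume (R : realType) (n k : nat)
    (phi : 'rV[R]_n -> 'rV[R]_k) (D : set 'rV[R]_n) : \bar R :=
  (\int[lebesgue_Rn R n]_(x in @Rn_vec R n @^-1` D)
     (Num.sqrt (\det ('J phi (Rn_vec x) *m ('J phi (Rn_vec x))^T)))%:E)%E.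

(* The library norm on row vectors is the sup norm. *)
Definition sqnorm (R : realType) (n : nat) (x : 'rV[R]_n) : R :=
  \sum_(i < n) x 0 i ^+ 2.

Definition open_unit_ball (R : realType) (n : nat) : set 'rV[R]_n :=
  [set x | sqnorm x < 1].

(* Chart of the open upper (s = 1) or lower (s = -1) unit hemisphere. *)
Definition hemisphere (R : realType) (n : nat) (s : R) (x : 'rV[R]_n) :
    'rV[R]_(n + 1) :=
  row_mx x (s * Num.sqrt (1 - sqnorm x))%:M.

(* Volume of the n-dimensional unit sphere in R^(n+1); the equator, which the
   two charts omit, has n-dimensional volume zero. *)
Definition omega (R : realType) (n : nat) : R :=
  fine (surface_volume (@hemisphere R n 1) (@open_unit_ball R n)
        + surface_volume (@hemisphere R n (-1)) (@open_unit_ball R n))%E.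

Definition sigma (R : realType) (n m : nat) (d b : 'I_m -> R) (j : 'I_m) : R :=
  if n == 2%N then d j / (4 * b j ^+ 2)
  else (n%:R - 2) / 2
       * (d j ^+ (n - 2) * omega R n.-1 / (b j ^+ n * omega R n)).

Definition rho (R : realType) (n m : nat) (b : 'I_m -> R) (j : 'I_m) : R :=
  b j ^+ n * omega R n.

(* Division being total, poles are excluded explicitly. *)
Definition spectral_root (R : realType) (m : nat) (s r : 'I_m -> R) (l : R) :=
  (forall j, l != s j) /\ 1 + \sum_(j < m) s j * r j / (s j - l) = 0.

(* mu enumerates the set of roots, numbered by interlacing. *)
Definition is_mu (R : realType) (m : nat) (s r mu : 'I_m -> R) :=
  [/\ range mu = [set l | spectral_root s r l],
      forall j, s j < mu j
    & forall i j : 'I_m, val j = (val i).+1 -> mu i < s j].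

(* Main.v *)
(* The residues are chosen so that, by partial fractions,
   [1 + sum_j sigma_j rho_j / (sigma_j - l) = prod_i (beta_i - l) / (alpha_i - l)]
   as soon as [sigma_j = alpha_j] and [alpha_j rho_j] is the residue at [alpha_j];
   interlacing then numbers the roots. Checking these two identities requires
   only [omega n > 0] and, for [n = 2], [omega 2 = 4 pi].

   In the chart of a hemisphere the volume density is [1 / sqrt (1 - |x|^2)], so
   [omega n = 2 I_n(1)] where [I_n(r)] is the integral of [1 / sqrt (r - |x|^2)]
   over the ball [|x|^2 < r]. Tonelli gives [I_(n+1)(r) = int_t I_n(r - t^2)],
   starting from the arcsine integral [I_1 = pi]. *)
Require Import Defs.
From HB Require Import structures.
From mathcomp Require Import all_boot all_order all_algebra.
From mathcomp Require Import all_classical all_reals all_analysis.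
From mathcomp Require Import measurable_realfun ring lra.

Set Implicit Arguments.
Unset Strict Implicit.
Unset Printing Implicit Defensive.

Import Order.TTheory GRing.Theory Num.Theory.
Import numFieldNormedType.Exports.

Local Open Scope classical_set_scope.
Local Open Scope ring_scope.

(** * Partial fractions for a quotient of split monic polynomials *)

(** Lagrange interpolation at the points [a k]. [A] and [B] are monic of the same degree m, so
    [B - A] has degree below m and is determined by its values [B.[a k]] at these m distinct points.
    Dividing by [A.[l]] gives the identity. *)
Lemma partial_fractions (F : fieldType) (m : nat) (a b : 'I_m -> F) (l : F) :
  injective a -> (forall i, l != a i) ->
  1 + \sum_(j < m) (b j - a j)
        * \prod_(i < m | i != j) ((b i - a j) / (a i - a j)) / (a j - l)
  = \prod_(i < m) ((b i - l) / (a i - l)).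
Proof.
move=> inj_a la.
pose A : {poly F} := \prod_(i < m) ('X - (a i)%:P).
pose B : {poly F} := \prod_(i < m) ('X - (b i)%:P).
pose c j := (b j - a j) * \prod_(i < m | i != j) ((b i - a j) / (a i - a j)).
pose Q j : {poly F} := \prod_(i < m | i != j) ('X - (a i)%:P).
have sizeQ j : (size (c j *: Q j) <= m)%N.
  rewrite (leq_trans (size_scale_leq _ _))// /Q -big_filter size_prod_XsubC.
  rewrite -sum1_size big_filter sum1_card cardC1 card_ord.
  by rewrite prednK// (leq_ltn_trans (leq0n j)).
have sizeBA : (size (B - A)%R <= m)%N.
  have Am : A \is monic by exact: monic_prod_XsubC.
  have Bm : B \is monic by exact: monic_prod_XsubC.
  have sA : size A = m.+1 by rewrite size_prod_XsubC -sum1_size sum1_card card_ord.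
  have sB : size B = m.+1 by rewrite size_prod_XsubC -sum1_size sum1_card card_ord.
  apply/leq_sizeP => k; rewrite leq_eqVlt => /predU1P[<-|mk].
    have lA : A`_m = 1 by move/monicP : Am; rewrite lead_coefE sA.
    have lB : B`_m = 1 by move/monicP : Bm; rewrite lead_coefE sB.
    by rewrite coefB lA lB subrr.
  by rewrite coefB !nth_default ?subrr ?sA ?sB.
have hA x : A.[x] = \prod_(i < m) (x - a i).
  by rewrite horner_prod; apply: eq_bigr => i _; rewrite hornerXsubC.
have hB x : B.[x] = \prod_(i < m) (x - b i).
  by rewrite horner_prod; apply: eq_bigr => i _; rewrite hornerXsubC.
have hQ j x : (Q j).[x] = \prod_(i < m | i != j) (x - a i).
  by rewrite horner_prod; apply: eq_bigr => i _; rewrite hornerXsubC.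
have diff0 i j : i != j -> a j - a i != 0.
  by move=> ij; rewrite subr_eq0 (inj_eq inj_a) eq_sym.
(* A nonzero polynomial of size at most m has fewer than m roots, whereas every [a k] is a root of
   the difference of the two sides. *)
have BAE : B - A = - \sum_(j < m) c j *: Q j.
  apply/eqP; rewrite -addr_eq0; apply/negP => /negP D0.
  have := max_poly_roots D0 (rs := [seq a i | i <- enum 'I_m]).
  rewrite size_map size_enum_ord map_inj_uniq ?enum_uniq// => /(_ _ isT).
  rewrite ltnNge (leq_trans (size_polyD _ _)); last first.
    rewrite geq_max sizeBA (leq_trans (size_sum _ _ _))//.
    by apply/bigmax_leqP => j _; exact: sizeQ.
  suff h : all (root (B - A + \sum_(j < m) c j *: Q j)) [seq a i | i <- enum 'I_m].
    by move=> /(_ h).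
  apply/allP => _ /mapP[k _ ->]; apply/eqP.
  (* At [a k] only the term of index k survives, since every other [Q j] contains the factor
     ['X - (a k)%:P]. *)
  rewrite !hornerE horner_sum (bigD1 k)//= big1 ?addr0; last first.
    move=> j jk; rewrite hornerZ hQ (bigD1 k) 1?eq_sym//= subrr mul0r mulr0 //.
  rewrite hA hB (bigD1 k)//= [\prod_(i < m) (a k - a i)](bigD1 k)//= subrr mul0r.
  rewrite subr0 hornerZ hQ /c -mulrA -big_split/=.
  (* The denominators of [c k] cancel against [(Q k).[a k]], each pair of factors leaving
     [a k - b i]; the sign of the leading factor [b k - a k] then makes the term cancel
     [B.[a k]]. *)
  rewrite [X in _ + _ * X](eq_bigr (fun i => a k - b i)).
    by rewrite -mulrDl addrA subrK subrr mul0r.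
  move=> i ik; have d0 := diff0 _ _ ik.
  by field; rewrite -opprB oppr_eq0.
have Al0 : A.[l] != 0.
  by rewrite hA; apply/prodf_neq0 => i _; rewrite subr_eq0.
have -> : \prod_(i < m) ((b i - l) / (a i - l)) = B.[l] / A.[l].
  rewrite hA hB -prodf_div; apply: eq_bigr => i _.
  by rewrite -(opprB l) -(opprB l (a i)) invrN mulrNN.
have -> : B = A + (B - A) by rewrite addrC subrK.
rewrite BAE hornerD hornerN mulrDl divff//; congr (1 + _).
rewrite horner_sum -sumrN mulr_suml; apply: eq_bigr => j _.
have p0 : \prod_(i < m | i != j) (l - a i) != 0.
  by apply/prodf_neq0 => i _; rewrite subr_eq0.
rewrite -/(c j) hornerZ hQ hA [\prod_(i < m) (l - a i)](bigD1 j)//=.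
by field; rewrite p0 !subr_eq0 [a j == l]eq_sym la.
Qed.

(** * Interlacing: signs of the residues and numbering of the roots *)

Section interlacing.
Variables (R : realType) (m : nat) (alpha beta : 'I_m -> R).
Hypothesis alpha_lt_beta : forall j, alpha j < beta j.
Hypothesis beta_lt_alpha : forall i j : 'I_m, val j = (val i).+1 -> beta i < alpha j.

(** This is the coefficient of 1 / (alpha_j - l) in the expansion of prod_i (beta_i - l) / (alpha_i
    - l), hence the opposite of the residue in the variable l. *)
Definition residue (j : 'I_m) : R := (beta j - alpha j)
  * \prod_(i < m | i != j) ((beta i - alpha j) / (alpha i - alpha j)).

(** The hypotheses compare only neighbouring indices; they are chained by induction on the gap j -
    i. *)
Lemma interlacing_lt (i j : 'I_m) : (i < j)%N -> beta i < alpha j.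
Proof.
have [k] := ubnP (j - i)%N; elim: k i => // k IH i jik ij.
have [/esym e|ne] := eqVneq i.+1 j; first exact: beta_lt_alpha.
have i1j : (i.+1 < j)%N by rewrite ltn_neqAle ne.
pose i1 : 'I_m := Ordinal (ltn_trans i1j (ltn_ord j)).
apply: (lt_trans (beta_lt_alpha (erefl (val i1)))).
apply: (lt_trans (alpha_lt_beta i1)); apply: IH => //=.
by rewrite subnS -ltnS prednK ?subn_gt0.
Qed.

Lemma interlacing_inj : injective alpha.
Proof.
have lt_neq (i j : 'I_m) : (i < j)%N -> alpha i < alpha j.
  by move=> /interlacing_lt; exact: lt_trans.
move=> i j eij; apply/val_inj; case: (ltngtP i j) => // /lt_neq.
  by rewrite eij ltxx.
by rewrite eij ltxx.
Qed.

(** In each factor the numerator and the denominator have the same sign: both are negative for i < j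
    and positive for i > j. *)
Lemma residue_gt0 (j : 'I_m) : 0 < residue j.
Proof.
rewrite /residue mulr_gt0 ?subr_gt0//; apply: prodr_gt0 => i ij.
case: (ltngtP i j) => [lij|lji|/val_inj eij]; last by rewrite eij eqxx in ij.
  have h := interlacing_lt lij.
  rewrite -mulrNN -invrN !opprB divr_gt0// subr_gt0//.
  exact: lt_trans (alpha_lt_beta i) h.
have h := lt_trans (alpha_lt_beta j) (interlacing_lt lji).
by rewrite divr_gt0// subr_gt0// (lt_trans h).
Qed.

(** Away from the poles the equation says that a product of quotients vanishes, that is, that one of
    its numerators does. Interlacing keeps each [beta j] away from all poles. *)
Lemma spectral_rootP (r : 'I_m -> R) (l : R) :
  (forall j, alpha j * r j = residue j) ->
  spectral_root alpha r l <-> exists j, l = beta j.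
Proof.
move=> rE; have eqn : (forall j, l != alpha j) ->
    1 + \sum_(j < m) alpha j * r j / (alpha j - l)
    = \prod_(i < m) ((beta i - l) / (alpha i - l)).
  move=> la; rewrite -(partial_fractions _ interlacing_inj la).
  by congr (1 + _); apply: eq_bigr => j _; rewrite rE.
split=> [[la]|[j lE]].
  rewrite eqn// => /eqP /prodf_eq0[j _].
  rewrite mulf_eq0 invr_eq0 !subr_eq0 [alpha j == l]eq_sym (negbTE (la j)) orbF.
  by move/eqP => <-; exists j.
have la i : l != alpha i.
  rewrite lE; have [ij|ij] := leqP i j; last by rewrite lt_eqF// interlacing_lt.
  rewrite gt_eqF//; move: ij; rewrite leq_eqVlt => /predU1P[/val_inj->//|].
  by move=> /interlacing_lt h; rewrite (lt_trans (alpha_lt_beta i))// (lt_trans h).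
by split=> //; rewrite eqn// (bigD1 j)//= lE subrr !mul0r.
Qed.

(** Each [mu j] is some [beta k], and the numbering forces k = j: if k < j then beta_k < alpha_j <
    mu_j, and if k > j the upper bound on [mu j] fails. *)
Lemma is_muP (r mu : 'I_m -> R) : (forall j, alpha j * r j = residue j) ->
  is_mu alpha r mu <-> forall j, mu j = beta j.
Proof.
move=> rE; split=> [[rangeE lt_mu mu_lt] j|muE].
  have [k muk] : exists k, mu j = beta k.
    by apply/(spectral_rootP _ rE); move/seteqP : rangeE => [+ _]; apply; exists j.
  rewrite muk; congr beta; apply/val_inj.
  case: (ltngtP k j) => // [kj|jk].
    have := lt_trans (interlacing_lt kj) (lt_mu j).
    by rewrite muk ltxx.
  (* Since j < k, the index j + 1 exists, and mu_j < alpha_(j+1) <= alpha_k < beta_k contradicts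
     mu_j = beta_k. *)
  pose j1 : 'I_m := Ordinal (leq_ltn_trans jk (ltn_ord k)).
  have := mu_lt j j1 erefl; rewrite muk ltNge; case/negP.
  rewrite ltW//; move: (jk); rewrite leq_eqVlt => /predU1P[e|j1k].
    by have -> : j1 = k by exact/val_inj.
  apply: lt_trans (alpha_lt_beta k).
  by apply: lt_trans (@interlacing_lt j1 k j1k); exact: alpha_lt_beta.
have -> : mu = beta by exact/funext.
split=> //; apply/seteqP; split=> [_ [j _ <-]|l]/=.
  by apply/(spectral_rootP _ rE); exists j.
by move=> /(spectral_rootP _ rE)[j ->]; exists j.
Qed.

End interlacing.

(** * The volume density of the hemisphere charts *)

Section hemisphere_jacobian.
Variable R : realType.

Lemma derive_coord (n : nat) (x v : 'rV[R]_n) (i : 'I_n) :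
  'D_v (fun y : 'rV[R]_n => y 0 i) x = v 0 i.
Proof.
have := congr1 (fun w : 'rV[R]_n => w 0 i) (derive_id x v).
by rewrite derive_mx ?mxE//; exact: derivable_id.
Qed.

Lemma is_derive_sqnorm (n : nat) (x v : 'rV[R]_n) :
  is_derive x v (@sqnorm R n) (2 * \sum_(i < n) x 0 i * v 0 i).
Proof.
have -> : @sqnorm R n = \sum_(i < n) (fun y : 'rV[R]_n => y 0 i) ^+ 2.
  by apply/funext => y; rewrite /sqnorm fct_sumE.
rewrite mulr_sumr; apply: is_derive_sum => i.
have dc : is_derive x v (fun y : 'rV[R]_n => y 0 i) (v 0 i).
  rewrite -(derive_coord x); apply/derivableP/diff_derivable.
  exact: differentiable_coord.
by apply: is_derive_eq; rewrite mulrA.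
Qed.

Lemma differentiable_sqnorm (n : nat) (x : 'rV[R]_n) :
  differentiable (@sqnorm R n) x.
Proof.
have -> : @sqnorm R n = \sum_(i < n) (fun y : 'rV[R]_n => y 0 i) ^+ 2.
  by apply/funext => y; rewrite /sqnorm fct_sumE.
apply: differentiable_sum => i; apply: differentiableX.
exact: differentiable_coord.
Qed.

Lemma is_diff_height (n : nat) (s : R) (x : 'rV[R]_n) :
  sqnorm x < 1 ->
  is_diff x (fun y : 'rV[R]_n => s * Num.sqrt (1 - sqnorm y))
    (fun v => - s / Num.sqrt (1 - sqnorm x) * \sum_(i < n) x 0 i * v 0 i).
Proof.
move=> x1; have y0 : 0 < 1 - sqnorm x by rewrite subr_gt0.
have ds : is_diff (1 - sqnorm x) Num.sqrt
    (fun h => h * (2 * Num.sqrt (1 - sqnorm x))^-1).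
  have D := is_derive1_sqrt y0.
  have d1 : derivable (Num.sqrt : R -> R) (1 - sqnorm x) 1 by [].
  apply: DiffDef; first exact/derivable1_diffP.
  by rewrite deriv1E// derive1E derive_val.
have dq : is_diff x (@sqnorm R n) (fun v => 2 * \sum_(i < n) x 0 i * v 0 i).
  apply: DiffDef; first exact: differentiable_sqnorm.
  apply/funext => v; rewrite -deriveE; last exact: differentiable_sqnorm.
  by have := is_derive_sqnorm x v => D; rewrite derive_val.
have d1q : is_diff x (cst 1 - @sqnorm R n) (0 - (fun v => 2 * \sum_(i < n) x 0 i * v 0 i)).
  exact: is_diffB.
have dc : is_diff x (s *: (Num.sqrt \o (cst 1 - @sqnorm R n)))
   (s *: ((fun h => h * (2 * Num.sqrt (1 - sqnorm x))^-1) \o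
      (0 - (fun v => 2 * \sum_(i < n) x 0 i * v 0 i)))).
  by apply: is_diffZ; apply: is_diff_comp.
apply: (is_diff_eq dc); apply/funext => v /=.
have alg (a q : R) : q != 0 -> s * ((0 - 2 * a) * (2 * q)^-1) = - s / q * a.
  by move=> q0; field.
by apply: alg; rewrite gt_eqF// sqrtr_gt0.
Qed.

Lemma differentiable_hemisphere (n : nat) (s : R) (x : 'rV[R]_n) :
  sqnorm x < 1 -> differentiable (@hemisphere R n s) x.
Proof.
move=> x1; have dh := is_diff_height s x1.
(* Writing the chart as a sum of scalar functions times constant vectors reduces its
   differentiability to that of the coordinates and of the height. *)
have -> : @hemisphere R n s =
    (\sum_(i < n) fun y : 'rV[R]_n => y 0 i *: row_mx (delta_mx 0 i) (0 : 'rV_1))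
    + (fun y => (s * Num.sqrt (1 - sqnorm y))
                *: row_mx (0 : 'rV_n) (1%:M : 'rV_1)).
  apply/funext => y; rewrite /hemisphere -[RHS]/(_ y + _) fct_sumE.
  rewrite (eq_bigr (fun i => row_mx (y 0 i *: delta_mx 0 i) (0 : 'rV_1))).
    rewrite scale_row_mx scaler0 scale_scalar_mx mulr1 {1}[y]row_sum_delta.
    rewrite -[X in row_mx X _]addr0 -{1}[X in row_mx _ X]add0r -add_row_mx.
    congr (_ + _); elim/big_rec2 : _ => [|i a b _ <-]; first by rewrite row_mx0.
    by rewrite add_row_mx addr0.
  by move=> i _; rewrite scale_row_mx scaler0.
apply: differentiableD; last exact: differentiableZl.
by apply: differentiable_sum => i; apply: differentiableZl; exact: differentiable_coord.
Qed.

Lemma jacobian_hemisphere (n : nat) (s : R) (x : 'rV[R]_n) : sqnorm x < 1 ->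
  'J (@hemisphere R n s) x
  = row_mx 1%:M ((- s / Num.sqrt (1 - sqnorm x)) *: x^T).
Proof.
move=> x1; have dH := differentiable_hemisphere s x1.
have dh := is_diff_height s x1.
apply/row_matrixP => i; rewrite rowE -deriveEjacobian//.
apply/rowP => k; rewrite derive_mx; last exact: diff_derivable.
rewrite [LHS]mxE; case: (split_ordP k) => j ->.
  rewrite [RHS]mxE row_mxEl.
  have -> : (fun y => @hemisphere R n s y 0 (lshift 1 j)) = (fun y => y 0 j).
    by apply/funext => y; rewrite /hemisphere row_mxEl.
  by rewrite derive_coord !mxE eqxx eq_sym.
rewrite [RHS]mxE row_mxEr.
have -> : (fun y => @hemisphere R n s y 0 (rshift n j))
    = (fun y => s * Num.sqrt (1 - sqnorm y)).
  by apply/funext => y; rewrite /hemisphere row_mxEr mxE (ord1 j) eqxx mulr1n.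
rewrite deriveE// diff_val !mxE (bigD1 i)//= big1 ?addr0 => [|l li].
  by rewrite !mxE !eqxx mulr1 ord1.
by rewrite !mxE (negbTE li) andbF mulr0.
Qed.

Lemma det_1_add_col_row (n : nat) (u : 'rV[R]_n) :
  \det (1%:M + u^T *m u) = 1 + (u *m u^T) 0 0.
Proof.
(* Schur complements of the two diagonal blocks *)
pose M := block_mx (1%:M : 'M[R]_n) (- u^T) u (1%:M : 'M[R]_1).
have M1 : M = block_mx 1%:M 0 u 1%:M *m block_mx 1%:M (- u^T) 0 (1%:M + u *m u^T).
  rewrite mulmx_block !(mul1mx, mulmx1, mulmx0, mul0mx, addr0, add0r) mulmxN.
  by rewrite addrC addrK.
have M2 : M = block_mx 1%:M (- u^T) 0 1%:M *m block_mx (1%:M + u^T *m u) 0 u 1%:M.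
  rewrite mulmx_block !(mul1mx, mulmx1, mulmx0, mul0mx, addr0, add0r) mulNmx.
  by rewrite addrK.
have : \det M = \det M by [].
rewrite {1}M1 M2 !det_mulmx !det_lblock !det_ublock !det1 !mul1r !mulr1 => <-.
by rewrite det_mx11 !mxE.
Qed.

(** The metric is 1 + c^2 x^T x with c^2 = 1 / (1 - |x|^2), of determinant 1 + |x|^2 / (1 - |x|^2) =
    1 / (1 - |x|^2). The sign s enters only through its square, so both hemispheres have the same
    density. *)
Lemma hemisphere_density (n : nat) (s : R) (x : 'rV[R]_n) :
  s ^+ 2 = 1 -> sqnorm x < 1 ->
  Num.sqrt (\det ('J (@hemisphere R n s) x *m ('J (@hemisphere R n s) x)^T))
  = (Num.sqrt (1 - sqnorm x))^-1.
Proof.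
move=> s1 x1; have y0 : 0 < 1 - sqnorm x by rewrite subr_gt0.
have q0 : Num.sqrt (1 - sqnorm x) != 0 by rewrite gt_eqF// sqrtr_gt0.
rewrite jacobian_hemisphere// tr_row_mx mul_row_col trmx1 mulmx1 linearZ/= trmxK.
set c := - s / _.
have -> : c *: x^T = (c *: x)^T by apply/matrixP => i k; rewrite !mxE.
rewrite det_1_add_col_row -sqrtrV ?ltW//; congr Num.sqrt.
have -> : ((c *: x) *m (c *: x)^T) 0 0 = c ^+ 2 * sqnorm x.
  rewrite mxE /sqnorm mulr_sumr; apply: eq_bigr => i _; rewrite !mxE.
  by rewrite -expr2 exprMn.
rewrite /c exprMn sqrrN s1 exprVn sqr_sqrtr ?ltW// mul1r.
by field; rewrite gt_eqF.
Qed.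

End hemisphere_jacobian.

(** * The arcsine integral *)

Section arcsine.
Variable R : realType.
Local Notation mu := (@lebesgue_measure R).

Lemma measurable_inv_sqrt : measurable_fun [set: R] (fun x : R => (Num.sqrt x)^-1).
Proof.
(* Inversion is discontinuous at 0, so measurability is taken from the real power of exponent -1,
   which agrees with it on nonnegative numbers, 0 included. *)
rewrite (_ : (fun _ => _) = (fun x => (Num.sqrt x) `^ (-1))).
  apply: (measurableT_comp (measurable_powR _)).
  exact: continuous_measurable_fun (@sqrt_continuous R).
by apply/funext => x; rewrite powR_inv1 ?sqrtr_ge0.
Qed.

Lemma inv_sqrt_out (r : R) : r <= 0 -> (Num.sqrt r)^-1 = 0.
Proof. by move=> r0; rewrite ler0_sqrtr// invr0. Qed.

Lemma is_derive_asin_scaled (q t : R) : - q < t < q ->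
  is_derive t 1 (fun u : R => asin (u / q)) (Num.sqrt (q ^+ 2 - t ^+ 2))^-1.
Proof.
move=> /andP[qt tq]; have q0 : 0 < q by lra.
have tq1 : -1 < t / q < 1.
  by rewrite ltr_pdivrMr// ltr_pdivlMr// mul1r mulN1r qt.
have D := is_derive1_asin tq1.
have Dq : is_derive t 1 (fun t : R => t / q) q^-1.
  have -> : (fun t : R => t / q) = q^-1 *: id by apply/funext => x; rewrite mulrC.
  by apply: is_derive_eq; rewrite [LHS]mulr1.
have := @is_derive1_comp R (@asin R) (fun t => t / q) t _ _ D Dq.
rewrite (_ : _ * q^-1 = (Num.sqrt (q ^+ 2 - t ^+ 2))^-1)//.
have -> : q ^+ 2 - t ^+ 2 = q ^+ 2 * (1 - (t / q) ^+ 2) by field; rewrite gt_eqF.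
by rewrite sqrtrM ?sqr_ge0// sqrtr_sqr gtr0_norm// invfM mulrC.
Qed.

Lemma continuous_inv_sqrt_diff (q t : R) : - q < t < q ->
  {for t, continuous (fun u : R => (Num.sqrt (q ^+ 2 - u ^+ 2))^-1)}.
Proof.
move=> /andP[qt tq].
have u0 : 0 < q ^+ 2 - t ^+ 2 by rewrite subr_sqr mulr_gt0//; lra.
apply: cvgV; first by rewrite gt_eqF// sqrtr_gt0.
apply: (@continuous_comp _ _ _ (fun u : R => q ^+ 2 - u ^+ 2) Num.sqrt); last first.
  exact: sqrt_continuous.
by apply: cvgB; [exact: cvg_cst|exact: exprn_continuous].
Qed.

(** The segment lies strictly inside ]-q, q[, where asin (t / q) is a primitive of the integrand;
    since [asin] inverts [sin] at [th] and [- th], its increment is 2 th. *)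
Lemma integral_arcsine_sin (q th : R) : 0 < q -> 0 < th < pi / 2 ->
  (\int[mu]_(t in `[(- (q * sin th))%R, (q * sin th)%R])
     ((Num.sqrt (q ^+ 2 - t ^+ 2))^-1)%:E = (2 * th)%:E)%E.
Proof.
move=> q0 /andP[th0 thpi].
have thI : th \in `[(- (pi / 2)), pi / 2] by rewrite in_itv/=; lra.
have s0 : 0 < sin th by apply: sin_gt0_pihalf; rewrite th0.
have s1 : sin th < 1.
  by rewrite -[ltRHS]sin_pihalf ltr_sin// in_itv/= lexx andbT; lra.
have qs : q * sin th < q by rewrite gtr_pMr.
have inI t : - (q * sin th) <= t <= q * sin th -> - q < t < q by lra.
have qs0 : 0 < q * sin th by rewrite mulr_gt0.
have [rl ll] : [/\ - (q * sin th) <= - (q * sin th) <= q * sin th &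
  - (q * sin th) <= (q * sin th) <= q * sin th] by split; lra.
have cF t : - (q * sin th) <= t <= q * sin th ->
    {for t, continuous (fun u : R => asin (u / q))}.
  move=> /inI tI; have D := is_derive_asin_scaled tI.
  by apply/differentiable_continuous/derivable1_diffP; exact: ex_derive.
rewrite (@continuous_FTC2 _ _ (fun u : R => asin (u / q))); first last.
- move=> t; rewrite in_itv/= => /andP[t1 t2].
  have D := @is_derive_asin_scaled q t (inI _ (introT andP (conj (ltW t1) (ltW t2)))).
  by rewrite derive1E derive_val.
- split.
  + move=> t; rewrite in_itv/= => /andP[t1 t2].
    by have D := @is_derive_asin_scaled q t (inI _ (introT andP (conj (ltW t1) (ltW t2)))); exact: ex_derive.
  + by apply: cvg_at_right_filter; exact: cF.
  + by apply: cvg_at_left_filter; exact: cF.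
- apply: continuous_in_subspaceT => t; rewrite inE/= in_itv/= => /inI.
  exact: continuous_inv_sqrt_diff.
- lra.
have e : q * sin th / q = sin th by field; rewrite gt_eqF.
by rewrite mulNr e -sinN !sinK ?in_itv/= -?EFinB ?opprK; [congr EFin; ring|lra..].
Qed.

Lemma integral_arcsine (r : R) : 0 < r ->
  (\int[mu]_(t in [set: R]) ((Num.sqrt (r - t ^+ 2))^-1)%:E = pi%:E)%E.
Proof.
move=> r0; pose q := Num.sqrt r.
have q0 : 0 < q by rewrite sqrtr_gt0.
have -> : r = q ^+ 2 by rewrite sqr_sqrtr// ltW.
have pi0 := @pi_gt0 R.
(* The integrand is unbounded at [-q] and [q]; exhaust the interval by segments
   with endpoints [q * sin th], on which the primitive is evaluated exactly. *)
pose th (k : nat) : R := pi / 2 - pi / 2 * harmonic k.+1.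
(* [harmonic k.+1] is 1 / (k + 2), which is below 1 already for k = 0; the shift makes [th 0]
   positive. *)
have thI k : 0 < th k < pi / 2.
  have h0 : (0 : R) < harmonic k.+1 by exact: harmonic_gt0.
  have h1 : harmonic k.+1 < (1 : R) by rewrite invf_lt1 ?ltr0n// ltr1n.
  by rewrite /th; nra.
have cvg_th : th k @[k --> \oo] --> pi / 2.
  rewrite -[X in _ --> X]subr0 -[X in _ --> _ - X](mulr0 (pi / 2)).
  apply: cvgB; first exact: cvg_cst.
  apply: cvgMr; have := @cvg_harmonic R; rewrite -cvg_shiftS; exact.
pose F (k : nat) : set R := [set` `[(- (q * sin (th k)))%R, (q * sin (th k))%R]].
have FP k t : F k t <-> `|t| <= q * sin (th k).
  by rewrite /F /= in_itv/= -ler_norml.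
have ler_sin_th (x : R) k : 0 <= x <= pi / 2 -> (sin x <= sin (th k)) = (x <= th k).
  move=> /andP[x0 x1]; have /andP[k0 k1] := thI k.
  by rewrite !leNgt ltr_sin// in_itv/=; lra.
have th_nd k l : (k <= l)%N -> th k <= th l.
  move=> kl; rewrite lerD2l lerN2 ler_pM2l; last lra.
  by rewrite lef_pV2 ?posrE ?ltr0n// ler_nat.
(* If |t| < q then asin (|t| / q) < pi / 2, and [th k] eventually exceeds it. *)
have bigcupF t : `|t| < q -> (\bigcup_k F k) t.
  move=> tq; pose y := `|t| / q.
  have y0 : 0 <= y by rewrite divr_ge0// ltW.
  have y1 : y < 1 by rewrite ltr_pdivrMr// mul1r.
  have yN1 : -1 <= y by lra.
  have y_le : -1 <= y <= 1 by rewrite yN1 ltW.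
  have ylt : asin y < pi / 2 by apply: asin_ltpi2; rewrite yN1.
  have [k _ /(_ _ (leqnn k))/= yk] := cvgr_gt _ cvg_th _ ylt.
  exists k => //; apply/FP; rewrite -ler_pdivrMl// mulrC -/y.
  rewrite -[y]asinK ?in_itv//= ler_sin_th; first exact: ltW.
  rewrite (ltW ylt) andbT leNgt; apply/negP => asin_lt0.
  have : sin (asin y) < sin 0.
    by rewrite ltr_sin// in_itv/= ?asin_geNpi2 ?asin_lepi2//; lra.
  by rewrite asinK ?in_itv//= sin0 ltNge y0.
have F_cvg : (\int[mu]_(t in F k) ((Num.sqrt (q ^+ 2 - t ^+ 2))^-1)%:E)%E @[k --> \oo]
    --> (\int[mu]_(t in \bigcup_k F k) ((Num.sqrt (q ^+ 2 - t ^+ 2))^-1)%:E)%E.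
  apply: ge0_nondecreasing_set_cvg_integral.
  - move=> k l kl; rewrite subsetEset => t /FP tk; apply/FP.
    rewrite (le_trans tk)// ler_pM2l// ler_sin_th ?th_nd//.
    by have /andP[? ?] := thI k; rewrite !ltW.
  - by move=> k; exact: measurable_itv.
  - move=> k; apply: measurable_funTS; apply/measurable_EFinP.
    apply: (measurableT_comp measurable_inv_sqrt).
    by apply: measurable_funB => //; exact: measurable_funX.
  - by move=> k t _; rewrite lee_fin invr_ge0 sqrtr_ge0.
(* Outside the union |t| >= q, where the integrand takes its default value 0. *)
have -> : (\int[mu]_(t in [set: R]) ((Num.sqrt (q ^+ 2 - t ^+ 2))^-1)%:E =
  \int[mu]_(t in \bigcup_k F k) ((Num.sqrt (q ^+ 2 - t ^+ 2))^-1)%:E)%E.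
  rewrite [RHS]integral_mkcond; apply: eq_integral => t _; rewrite patchE.
  case: ifPn => //; rewrite notin_setE => tF; rewrite inv_sqrt_out//.
  rewrite subr_le0 -[leRHS]real_normK ?num_real// ler_pXn2r ?nnegrE ?(ltW q0)//.
  by rewrite leNgt; apply/negP => /bigcupF.
apply: (cvg_unique _ F_cvg) => //.
have -> : (fun k => \int[mu]_(t in F k) ((Num.sqrt (q ^+ 2 - t ^+ 2))^-1)%:E)%E
    = EFin \o (fun k => 2 * th k).
  by apply/funext => k; exact: integral_arcsine_sin.
apply: cvg_EFin; first by near=> k.
have -> : pi = 2 * (pi / 2) :> R by field.
by apply: cvgMr.
Unshelve. all: by end_near. Qed.

End arcsine.

(** * The integrals I_n(r) and the values of omega *)

Section ball_integral.
Variable R : realType.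
Local Notation mu := (@lebesgue_measure R).

Lemma sqnorm_Rn_vecS (n : nat) (t : R) (x : Rn R n) :
  sqnorm (@Rn_vec R n.+1 (t, x)) = t ^+ 2 + sqnorm (Rn_vec x).
Proof.
rewrite /sqnorm -[Rn_vec _]/(row_mx t%:M (Rn_vec x)) (@big_split_ord _ _ _ 1 n).
rewrite big_ord1; congr (_ ^+ 2 + _).
  by rewrite (row_mxEl (t%:M : 'rV_1) (Rn_vec x) 0 ord0) mxE.
by apply: eq_bigr => i _; rewrite (row_mxEr (t%:M : 'rV_1) (Rn_vec x) 0 i).
Qed.

Lemma sqnorm_Rn_vec0 (x : Rn R 0) : sqnorm (Rn_vec x) = 0.
Proof. by rewrite /sqnorm big_ord0. Qed.

Lemma measurable_sqnorm (n : nat) :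
  measurable_fun [set: Rn R n] (fun x => sqnorm (Rn_vec x)).
Proof.
elim: n => [|n IH].
  by rewrite (_ : (fun _ => _) = cst 0)//; apply/funext => x; exact: sqnorm_Rn_vec0.
rewrite (_ : (fun _ => _) = (fun z : R * Rn R n => z.1 ^+ 2 + sqnorm (Rn_vec z.2))).
  apply: measurable_funD; first by apply: measurable_funX; exact: measurable_fst.
  exact: measurableT_comp IH measurable_snd.
by apply/funext => -[t x]; exact: sqnorm_Rn_vecS.
Qed.

(* [Num.sqrt] vanishes on negative numbers and [0^-1 = 0], so the integrand is
   supported on the open ball of radius [sqrt r]. *)
Definition ball_integral (n : nat) (r : R) : \bar R :=
  (\int[lebesgue_Rn R n]_(x in [set: Rn R n])
     ((Num.sqrt (r - sqnorm (Rn_vec x)))^-1)%:E)%E.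

Lemma ball_integral_npos (n : nat) (r : R) : r <= 0 -> ball_integral n r = 0%E.
Proof.
move=> r0; apply: integral0_eq => x _; rewrite inv_sqrt_out//.
rewrite subr_le0 (le_trans r0)//; apply: sumr_ge0 => i _; exact: sqr_ge0.
Qed.

Lemma measurable_ball_integrand (n : nat) (r : R) :
  measurable_fun [set: Rn R n]
    (fun x => ((Num.sqrt (r - sqnorm (Rn_vec x)))^-1)%:E).
Proof.
apply/measurable_EFinP.
apply: (measurableT_comp (@measurable_inv_sqrt R)).
by apply: measurable_funB => //; exact: measurable_sqnorm.
Qed.

Lemma ball_integral_ge0 (n : nat) (r : R) : (0 <= ball_integral n r)%E.
Proof. by apply: integral_ge0 => x _; rewrite lee_fin invr_ge0 sqrtr_ge0. Qed.

Lemma ball_integralS (n : nat) (r : R) :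
  ball_integral n.+1 r = (\int[mu]_(t in [set: R]) ball_integral n (r - t ^+ 2))%E.
Proof.
rewrite /ball_integral.
have := @fubini_tonelli1 _ _ (measurableTypeR R) (Rn R n) R mu (lebesgue_Rn R n) _
  (@measurable_ball_integrand n.+1 r).
move=> /(_ _)/= h.
etransitivity; first by apply: h => x; rewrite lee_fin invr_ge0 sqrtr_ge0.
apply: eq_integral => t _; rewrite /fubini_F; apply: eq_integral => x _.
by rewrite sqnorm_Rn_vecS opprD addrA.
Qed.

Lemma measurable_ball_integral_slice (n : nat) (r : R) :
  measurable_fun [set: R] (fun t => ball_integral n (r - t ^+ 2)).
Proof.
have := @measurable_fun_fubini_tonelli_F _ _ (measurableTypeR R) (Rn R n) R
  (lebesgue_Rn R n) _ (@measurable_ball_integrand n.+1 r).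
move=> /(_ _)/= h.
rewrite (_ : (fun _ => _) = fubini_F (lebesgue_Rn R n) (fun x : Rn R n.+1 =>
   ((Num.sqrt (r - sqnorm (Rn_vec x)))^-1)%:E)).
  by apply: h => x; rewrite lee_fin invr_ge0 sqrtr_ge0.
apply/funext => t; apply: eq_integral => x _.
by rewrite sqnorm_Rn_vecS opprD addrA.
Qed.

Lemma ball_integral0 (r : R) : ball_integral 0 r = ((Num.sqrt r)^-1)%:E.
Proof.
rewrite /ball_integral (@integral_dirac _ _ tt)//.
by rewrite diracT mul1e sqnorm_Rn_vec0 subr0.
Qed.

Lemma ball_integral1 (r : R) : 0 < r -> ball_integral 1 r = pi%:E.
Proof.
move=> r0; rewrite ball_integralS -(integral_arcsine r0).
by apply: eq_integral => t _; rewrite ball_integral0.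
Qed.

(** The slice at t has parameter r^2 - t^2: it contributes c for |t| < r and nothing otherwise, so
    the total is c times the length 2 r. *)
Lemma ball_integral_cst (n : nat) (r c : R) : 0 < r ->
  (forall s, 0 < s <= r ^+ 2 -> ball_integral n s = c%:E) ->
  ball_integral n.+1 (r ^+ 2) = (2 * r * c)%:E.
Proof.
move=> r0 Ic; rewrite ball_integralS.
have rr : (- r < r) by rewrite gtrN.
transitivity (\int[mu]_(t in `](- r)%R, r[) (cst c%:E t))%E.
  rewrite [RHS]integral_mkcond; apply: eq_integral => t _; rewrite patchE.
  case: ifPn => [|].
    rewrite inE/= in_itv/= -ltr_norml => tr; rewrite Ic// gerBl ?sqr_ge0// andbT.
    by rewrite subr_gt0 -[ltLHS]real_normK ?num_real// ltr_pXn2r ?nnegrE// ltW.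
  rewrite notin_setE/= in_itv/= -ltr_norml => /negP; rewrite -leNgt => rt.
  rewrite ball_integral_npos// subr_le0 -[leRHS]real_normK ?num_real//.
  by rewrite ler_pXn2r ?nnegrE// ltW.
rewrite integral_cst//= lebesgue_measure_itv/= lte_fin rr -EFinB -EFinM.
by congr EFin; ring.
Qed.

Lemma ball_integral2 : ball_integral 2 1 = (2 * pi)%:E.
Proof.
rewrite -[X in ball_integral 2 X](expr1n _ 2) (ball_integral_cst (c := pi))//.
  by rewrite mulr1.
by move=> s /andP[s0 _]; exact: ball_integral1.
Qed.

(** Positivity of [omega] needs both bounds, because [fine] sends an infinite volume to 0. The
    induction starts in dimension 1, as I_0(r) = 1 / sqrt r is unbounded near 0; the lower bound
    decays with r because the parameters of the slices do. *)
Lemma ball_integral_bounds (n : nat) : exists c C : R, [/\ 0 < c, 0 < C &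
  forall r, 0 < r <= 1 ->
    ((c * r ^+ n)%:E <= ball_integral n.+1 r <= C%:E)%E].
Proof.
elim: n => [|n [c [C [c0 C0 IH]]]].
  exists pi, pi; split; rewrite ?pi_gt0// => r /andP[r0 _].
  by rewrite ball_integral1// expr0 mulr1 lexx.
exists (c / 2 ^+ n), (2 * C); split; rewrite ?divr_gt0 ?exprn_gt0 ?mulr_gt0//.
move=> r /andP[r0 r1]; rewrite ball_integralS.
have mI (A : set R) : measurable A ->
    measurable_fun A (fun t : R => ball_integral n.+1 (r - t ^+ 2)).
  by move=> mA; apply: measurable_funS (@measurable_ball_integral_slice n.+1 r).
apply/andP; split.
  (* For |t| <= r / 2 and r <= 1 one has t^2 <= r / 2, so the parameter r - t^2 is at least r /
     2. *)
  apply: (@le_trans _ _ (\int[mu]_(t in `[(- (r / 2))%R, (r / 2)%R])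
      ball_integral n.+1 (r - t ^+ 2))%E); last first.
    by apply: ge0_subset_integral => //=; [exact: mI|move=> *; exact: ball_integral_ge0].
  apply: (@le_trans _ _ (\int[mu]_(t in `[(- (r / 2))%R, (r / 2)%R])
      cst (c * (r / 2) ^+ n)%:E t)%E).
    rewrite integral_cst//= lebesgue_measure_itv/= lte_fin.
    have -> : - (r / 2) < r / 2 by lra.
    rewrite -EFinB -EFinM lee_fin exprS expr_div_n.
    suff -> : c / 2 ^+ n * (r * r ^+ n)
      = c * (r ^+ n / 2 ^+ n) * (r / 2 - - (r / 2)) by [].
    by field; rewrite expf_neq0.
  apply: ge0_le_integral => //=.
  - by move=> t _; rewrite lee_fin mulr_ge0 ?exprn_ge0 ?ltW// divr_gt0.
  - exact: mI.
  - move=> t; rewrite in_itv/= => /andP[t1 t2].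
    have t2r : t ^+ 2 <= r / 2 by nra.
    have tr : 0 < r - t ^+ 2 <= 1.
      by have := sqr_ge0 t; move: t2r; move: (t ^+ 2) => u; lra.
    have /andP[+ _] := IH _ tr; apply: le_trans; rewrite lee_fin ler_pM2l//.
    by apply: lerXn2r; rewrite ?nnegrE; lra.
(* For |t| > 1 the parameter r - t^2 is negative, so the slice vanishes. *)
apply: (@le_trans _ _ (\int[mu]_(t in `[(-1)%R, 1%R : R]) cst C%:E t)%E); last first.
  rewrite integral_cst//= lebesgue_measure_itv/= lte_fin.
  have -> : (-1 < 1 :> R) by lra.
  by rewrite -EFinB -EFinM lee_fin; lra.
rewrite [leRHS]integral_mkcond; apply: ge0_le_integral => //=.
- by move=> t _; exact: ball_integral_ge0.
- exact: mI.
- by apply/(measurable_restrictT (cst C%:E)); [exact: measurable_itv|exact: measurable_cst].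
- move=> t _; rewrite patchE; case: ifPn => [_|].
    have [rt|rt] := leP (r - t ^+ 2) 0.
      by rewrite ball_integral_npos// lee_fin ltW.
    have tr : 0 < r - t ^+ 2 <= 1.
      by rewrite rt/=; have := sqr_ge0 t; move: (t ^+ 2) => u; lra.
    by have /andP[] := IH _ tr.
  rewrite notin_setE/= in_itv/= => tN.
  rewrite ball_integral_npos// leNgt; apply/negP => rt; apply: tN.
  by apply/andP; split; nra.
Qed.

Lemma surface_volume_hemisphere (n : nat) (s : R) : s ^+ 2 = 1 ->
  surface_volume (@hemisphere R n s) (@open_unit_ball R n) = ball_integral n 1.
Proof.
move=> s1; rewrite /surface_volume integral_mkcond; apply: eq_integral => x _.
rewrite patchE; case: ifPn => [|].
  by rewrite inE /= => x1; rewrite hemisphere_density.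
rewrite notin_setE /= /open_unit_ball/= => /negP; rewrite -leNgt => x1.
by rewrite inv_sqrt_out// subr_le0.
Qed.

Lemma omegaE (n : nat) : omega R n = fine (ball_integral n 1 + ball_integral n 1)%E.
Proof. by rewrite /omega !surface_volume_hemisphere ?sqrrN ?expr1n. Qed.

Lemma omega_gt0 (n : nat) : (0 < n)%N -> 0 < omega R n.
Proof.
case: n => // n _; have [c [C [c0 C0 /(_ 1)]]] := ball_integral_bounds n.
rewrite ltr01 lexx expr1n mulr1 => /(_ isT); rewrite omegaE.
case: (ball_integral n.+1 1) => [v| |]//=; last by rewrite leye_eq andbF.
by rewrite !lee_fin => /andP[cv _]; rewrite addr_gt0// (lt_le_trans c0).
Qed.

Lemma omega2 : omega R 2 = 4 * pi.
Proof. by rewrite omegaE ball_integral2/=; ring. Qed.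

End ball_integral.

(** * From the radii to sigma and rho *)

Lemma powR_inv_natK (R : realType) (x : R) (k : nat) : 0 <= x -> (0 < k)%N ->
  (x `^ (1 / k%:R)) ^+ k = x.
Proof.
move=> x0 k0; rewrite -powR_mulrn ?powR_ge0// -powRrM div1r mulVf ?powRr1//.
by rewrite pnatr_eq0 -lt0n.
Qed.

Section solution.
Variables (R : realType) (n m : nat) (alpha beta d b : 'I_m -> R).
Hypothesis n_ge2 : (2 <= n)%N.
Hypothesis alpha_gt0 : forall j, 0 < alpha j.
Hypothesis residue_pos : forall j, 0 < residue alpha beta j.
Hypothesis radiusE : forall j,
  b j = (residue alpha beta j / (omega R n * alpha j)) `^ (1 / n%:R).

Lemma bubble_radius_exp (j : 'I_m) :
  b j ^+ n = residue alpha beta j / (omega R n * alpha j).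
Proof.
have n0 : (0 < n)%N by exact: ltnW.
by rewrite radiusE powR_inv_natK// ltW// divr_gt0// mulr_gt0// omega_gt0.
Qed.

(** The factor [omega R n] of [rho] cancels the one in the bubble radius. This is the condition
    under which [is_muP] identifies the roots. *)
Lemma alpha_mul_rho (j : 'I_m) : alpha j * rho n b j = residue alpha beta j.
Proof.
rewrite /rho bubble_radius_exp.
have o0 : omega R n != 0 by rewrite gt_eqF// omega_gt0// ltnW.
have a0 : alpha j != 0 by rewrite gt_eqF.
by field; rewrite a0 o0.
Qed.

(** The relevant powers of [d j] and [b j] are both proportional to the residue, which cancels in
    [sigma]. For n = 2 there remains alpha_j omega_2 / (4 pi). *)
Lemma sigma_eq_alpha :
  (forall j, d j = if n == 2%N then residue alpha beta j / pi
     else (2 * residue alpha beta j / (omega R n.-1 * (n%:R - 2)))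
          `^ (1 / (n%:R - 2))) ->
  forall j, sigma n d b j = alpha j.
Proof.
move=> dE j; have a0 : alpha j != 0 by rewrite gt_eqF.
have res0 : residue alpha beta j != 0 by rewrite gt_eqF.
have bE := bubble_radius_exp j.
(* Generalising [pi] to a variable p makes it an atom for [field]; its positivity and omega_2 = 4 p
   are kept. *)
have := @pi_gt0 R; move: (pi : R) (omega2 R) dE => p omega2_p dE p_gt0.
rewrite /sigma dE; have [n2|n2] := eqVneq n 2%N.
  by move: bE; rewrite n2 omega2_p => ->; field; rewrite res0 a0 gt_eqF.
have n3 : (2 < n)%N by rewrite ltn_neqAle eq_sym n2.
have n20 : (n%:R - 2 : R) != 0 by rewrite subr_eq0 eqr_nat.
have n1 : (0 < n.-1)%N by rewrite -subn1 subn_gt0.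
have o0 : omega R n != 0 by rewrite gt_eqF// omega_gt0// ltnW.
have o1 : omega R n.-1 != 0 by rewrite gt_eqF// omega_gt0.
(* The real exponent n - 2 must be read as the cast of a natural number before the root and the
   power cancel. *)
rewrite bE -(natrB _ n_ge2) powR_inv_natK ?subn_gt0//; last first.
  rewrite ltW//; apply: divr_gt0; first exact: mulr_gt0.
  by apply: mulr_gt0; [exact: omega_gt0|rewrite ltr0n subn_gt0].
by rewrite (natrB _ n_ge2); field; rewrite res0 a0 o0 o1 n20.
Qed.

End solution.

Theorem theorem4p1 (R : realType) (n m : nat) (hn : (2 <= n)%N) (hm : (0 < m)%N)
    (alpha beta : 'I_m -> R)
    (h0 : 0 < alpha (Ordinal hm))
    (hab : forall j, alpha j < beta j)
    (hba : forall i j : 'I_m, val j = (val i).+1 -> beta i < alpha j)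
    (d b : 'I_m -> R)
    (hd : forall j, d j =
       if n == 2%N then
         (beta j - alpha j) / pi
         * \prod_(i < m | i != j) ((beta i - alpha j) / (alpha i - alpha j))
       else
         (2 * (beta j - alpha j) / (omega R n.-1 * (n%:R - 2))
          * \prod_(i < m | i != j) ((beta i - alpha j) / (alpha i - alpha j)))
         `^ (1 / (n%:R - 2)))
    (hb : forall j, b j =
       ((beta j - alpha j) / (omega R n * alpha j)
        * \prod_(i < m | i != j) ((beta i - alpha j) / (alpha i - alpha j)))
       `^ (1 / n%:R)) :
  (forall j, sigma n d b j = alpha j)
  /\ (forall mu : 'I_m -> R,
        is_mu (sigma n d b) (rho n b) mu <-> (forall j, mu j = beta j)).
Proof.
(* Only the first alpha is assumed positive; interlacing puts all the others above it. *)
have alpha_gt0 j : 0 < alpha j.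
  have [<-//|j0] := eqVneq (Ordinal hm) j.
  apply: lt_trans h0 (lt_trans (hab _) (interlacing_lt hab hba _)).
  by rewrite lt0n; apply: contraNneq j0 => j0; exact/eqP/val_inj.
have res_gt0 := residue_gt0 hab hba.
have bE j : b j = (residue alpha beta j / (omega R n * alpha j)) `^ (1 / n%:R).
  by rewrite hb /residue mulrAC.
have sigmaE : sigma n d b = alpha.
  apply/funext; apply: (sigma_eq_alpha hn alpha_gt0 res_gt0 bE) => j.
  rewrite hd /residue; case: ifP => _; first by rewrite mulrAC.
  by congr (_ `^ _); rewrite [LHS]mulrAC mulrA.
split=> [j|mu]; first by rewrite sigmaE.
by rewrite sigmaE; apply: is_muP => // j; exact: alpha_mul_rho.
Qed.
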